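(* Let $c:\{0,1\}^n\to\mathbb{R}$ be an arbitrary cost function. For QAOA$_1$ with parameters $\gamma,\beta\in\mathbb{R}$, to lowest order in $\gamma,\beta$ the probability of measuring $x\in\{0,1\}^n$ is $$P_1(x)\;\simeq\;P_0(x)-\frac{2\gamma\beta}{2^n}\,dc(x),\qquad P_0(x)=\frac1{2^n},$$ and the expected value of the cost Hamiltonian is $$\langle C\rangle_1\;\simeq\;\langle C\rangle_0-\frac{2\gamma\beta}{2^n}\sum_{x\in\{0,1\}^n}c(x)\,dc(x),$$ where in both formulas the neglected terms are of total degree $4$ or higher in $\gamma,\beta$ (i.e. in the convergent power series in $(\gamma,\beta)$ of each left-hand side, the displayed right-hand side contains all terms of total degree at most $3$). Moreover, for any non-constant $c$, $$\sum_{x\in\{0,1\}^n}c(x)\,dc(x)<0 .$$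
   Context: Work on $n$ qubits with computational basis $\{|x\rangle : x\in\{0,1\}^n\}$. For a cost function $c:\{0,1\}^n\to\mathbb{R}$, the cost Hamiltonian is the diagonal operator $C=\sum_x c(x)|x\rangle\langle x|$. The mixing Hamiltonian is $B=\sum_{j=1}^n X_j$ ($X_j$ the Pauli $X$ on qubit $j$), and the initial state is $|s\rangle=2^{-n/2}\sum_x|x\rangle$. The QAOA$_1$ state is $|\gamma\beta\rangle=e^{-i\beta B}e^{-i\gamma C}|s\rangle$; $P_1(x)=|\langle x|\gamma\beta\rangle|^2$ and $\langle C\rangle_1=\langle\gamma\beta|C|\gamma\beta\rangle$. $\langle A\rangle_0=\langle s|A|s\rangle$, so $\langle C\rangle_0=2^{-n}\sum_x c(x)$. Let $x^{(j)}$ be $x$ with its $j$th bit flipped; the partial difference is $\partial_jc(x)=c(x^{(j)})-c(x)$ and the cost divergence is $dc(x)=\sum_{j=1}^n\partial_jc(x)$. *)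

(* Defs.v *)
From HB Require Import structures.
From mathcomp Require Import all_boot all_order all_algebra.
From mathcomp Require Import complex.
From mathcomp Require Import all_classical all_reals all_analysis.

Set Implicit Arguments.
Unset Strict Implicit.
Unset Printing Implicit Defensive.

Import Order.TTheory GRing.Theory Num.Theory.
Import numFieldNormedType.Exports.

Local Open Scope classical_set_scope.
Local Open Scope ring_scope.
Local Open Scope complex_scope.

Notation bits n := {ffun 'I_n -> bool}.

Definition flip n (x : bits n) (j : 'I_n) : bits n :=
  [ffun k => if k == j then ~~ x k else x k].

Section CostFunction.
Context {R : realType} {n : nat}.
Implicit Type c : bits n -> R.

Definition pdiff c (j : 'I_n) (x : bits n) : R := c (flip x j) - c x.

Definition cost_div c (x : bits n) : R := \sum_(j < n) pdiff c j x.

End CostFunction.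

(* The limit is taken in the library topology of 'M[K]_m, i.e. entrywise. *)
Definition expmx (K : numFieldType) (m : nat) (A : 'M[K]_m) : 'M[K]_m :=
  limn (series (fun k => (k`!%:R)^-1 *: A ^+ k)).

(* Rows and columns are indexed by the bit strings, through their canonical
   enumeration. *)
Notation operator R n := 'M[R[i]]_#|{: bits n}|.
Notation state R n := 'cV[R[i]]_#|{: bits n}|.

Definition adjmx (R : rcfType) (p q : nat) (A : 'M[R[i]]_(p, q)) :
  'M[R[i]]_(q, p) := (map_mx conjc A)^T.

Section QAOA.
Context {R : realType} {n : nat}.
Implicit Types (x : bits n) (c : bits n -> R) (psi : state R n).

Definition ket x : state R n := delta_mx (enum_rank x) 0.

Definition cost_ham c : operator R n :=
  \sum_(x : bits n) (c x)%:C *: (ket x *m adjmx (ket x)).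

Definition pauliX : 'M[R[i]]_2 := \matrix_(a, b) (a != b)%:R.

(* The Kronecker product A_0 (x) ... (x) A_(n-1): its (x, y) entry is the
   product over k of the (x_k, y_k) entries. *)
Definition tensor_op (A : 'I_n -> 'M[R[i]]_2) : operator R n :=
  \matrix_(p, q)
    \prod_(k < n) A k (inord ((enum_val p : bits n) k)) (inord ((enum_val q : bits n) k)).

Definition X_op (j : 'I_n) : operator R n :=
  tensor_op (fun k => if k == j then pauliX else 1%:M).

Definition mixing_ham : operator R n := \sum_(j < n) X_op j.

Definition init_state : state R n :=
  ((Num.sqrt (2 ^+ n))^-1)%:C *: \sum_(x : bits n) ket x.

Definition qaoa_state c (g b : R) : state R n :=
  expmx (- ('i * b%:C) *: mixing_ham) *m
  (expmx (- ('i * g%:C) *: cost_ham c) *m init_state).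

Definition prob psi x : R := ComplexField.Normc.normc ((adjmx (ket x) *m psi) 0 0) ^+ 2.

(* <psi|A|psi>; the real part is taken only to land in R, see
   [expectation_cost_hamE]. *)
Definition expectation psi (A : operator R n) : R :=
  complex.Re ((adjmx psi *m A *m psi) 0 0).

Definition P0 x : R := prob init_state x.
Definition P1 c (g b : R) x : R := prob (qaoa_state c g b) x.
Definition E0 c : R := expectation init_state (cost_ham c).
Definition E1 c (g b : R) : R := expectation (qaoa_state c g b) (cost_ham c).

Lemma adjmx_ket_mul x psi : adjmx (ket x) *m psi = (psi (enum_rank x) 0)%:M.
Proof.
apply/matrixP => i j; rewrite !ord1 !mxE (bigD1 (enum_rank x)) //= big1 => [|k kx].
  by rewrite !mxE !eqxx /= oppr0 mul1r addr0.
by rewrite !mxE (negbTE kx) /= oppr0 mul0r.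
Qed.

Lemma cost_ham_ket c x : cost_ham c *m ket x = (c x)%:C *: ket x.
Proof.
rewrite mulmx_suml (bigD1 x) //= big1 => [|y yx].
  by rewrite addr0 -scalemxAl -mulmxA adjmx_ket_mul !mxE !eqxx mulmx1.
rewrite -scalemxAl -mulmxA adjmx_ket_mul !mxE (inj_eq enum_rank_inj).
by rewrite (negbTE yx) raddf0 mulmx0 scaler0.
Qed.

Lemma X_op_ket j x : X_op j *m ket x = ket (flip x j).
Proof.
apply/matrixP => p q; rewrite !ord1 mxE (bigD1 (enum_rank x)) //= big1 => [|k kx].
  rewrite !mxE eqxx /= mulr1 addr0 andbT enum_rankK.
  have -> : (p == enum_rank (flip x j)) = (enum_val p == flip x j).
    by rewrite -{2}(enum_rankK (flip x j)) (inj_eq enum_val_inj).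
  have b2 (a b : bool) : ((inord a : 'I_2) == inord b) = (a == b).
    by apply/eqP/eqP => [/(congr1 val)|->//]; case: a; case: b; rewrite /= ?inordK.
  case: eqP => [->|ne].
    rewrite big1 // => k _; rewrite /flip ffunE.
    by case: eqP => _; rewrite mxE b2 ?eqxx //; case: (x k).
  have [k kne] : exists k, enum_val p k != flip x j k.
    by apply/existsP; rewrite -negb_forall; apply/negP => /forallP H;
       apply: ne; apply/ffunP => k; apply/eqP.
  rewrite (bigD1 k) //= [X in X * _](_ : _ = 0) ?mul0r //.
  move: kne; rewrite /flip ffunE.
  by case: (k == j); rewrite mxE b2; case: (enum_val p k); case: (x k).
by rewrite [ket x _ _]mxE (negbTE kx) mulr0.
Qed.

Lemma expectation_cost_hamE c psi :
  (adjmx psi *m cost_ham c *m psi) 0 0 = (expectation psi (cost_ham c))%:C.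
Proof.
rewrite /expectation RRe_real //.
rewrite /cost_ham mulmx_sumr mulmx_suml summxE rpred_sum // => x _.
rewrite -scalemxAr -scalemxAl mxE mulmxA -(mulmxA (_ *m ket x)) adjmx_ket_mul.
have -> : adjmx psi *m ket x = (conjc (psi (enum_rank x) 0))%:M.
  apply/matrixP => i j; rewrite !ord1 !mxE (bigD1 (enum_rank x)) //= big1.
    by rewrite !mxE !eqxx /= mulr1 addr0.
  by move=> k kx; rewrite !mxE (negbTE kx) mulr0.
rewrite -scalar_mxM mxE eqxx mulr1n rpredM ?complex_real //.
by rewrite mulrC -sqr_normc rpredX ?normr_real.
Qed.

End QAOA.

Section PowerSeries.
Context {R : realType}.
Implicit Types (a : nat -> nat -> R) (f p : R -> R -> R).

(* The part of total degree N of the sum of the a j k * g ^+ j * b ^+ k. *)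
Definition homog a (g b : R) (N : nat) : R :=
  \sum_(j < N.+1) a j (N - j)%N * g ^+ j * b ^+ (N - j)%N.

(* Absolute convergence makes the order of summation immaterial. *)
Definition power_series2 f a : Prop :=
  forall g b : R,
    cvgn (series (homog (fun j k => `|a j k|) `|g| `|b|)) /\
    series (homog a g b) @ \oo --> f g b.

Definition eq_upto_degree (d : nat) f p : Prop :=
  exists a, power_series2 f a /\
    forall g b : R, p g b = \sum_(N < d.+1) homog a g b N.

End PowerSeries.

(* Main.v *)
(** The mixing Hamiltonian B is diagonal in the Hadamard basis and C is diagonal
    in the computational basis, so the amplitude of |x> in the QAOA state is a
    finite real combination \sum_p w_p e^(-i t_p), where t_p = g c_q + b l_y for
    p = (y, q) and l_y is an eigenvalue of B.  Hence
      P_1(x) = \sum_(p, p') w_p w_p' cos (t_p - t_p'),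
    a finite sum of cosines of linear forms in (g, b).  Each is an entire double
    power series without odd terms (by the binomial theorem, so no product of
    power series is needed), and the part of degree at most 2 is
      S_0^2 + S_1^2 - S_0 S_2,  where S_k = \sum_p w_p t_p^k.
    Summing over y and q, S_k = <x| :(g C + b B)^k: |s> for k <= 2, with the
    powers of B to the left of those of C.  Finally, since flipping a bit is an
    involution, \sum_x c(x) dc(x) = - (1/2) \sum_(x, j) (partial_j c(x))^2. *)
Require Import Defs.
From mathcomp Require Import all_boot all_order all_algebra.
From mathcomp Require Import complex ring.
From mathcomp Require Import all_classical all_reals all_analysis.

Set Implicit Arguments.
Unset Strict Implicit.
Unset Printing Implicit Defensive.

Import Order.TTheory GRing.Theory Num.Theory.
Import numFieldNormedType.Exports.

Local Open Scope classical_set_scope.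
Local Open Scope ring_scope.
Local Open Scope complex_scope.

(** * Double power series of functions of a linear form, and their finite combinations *)

Section PowerSeries.
Context {R : realType}.
Implicit Types (e : nat -> R) (d l g b : R) (N : nat).

(** The coefficient of g^j b^k in [\sum_N e N * (d * g + l * b) ^+ N], by the binomial theorem. *)
Definition linear_coef e d l (j k : nat) : R :=
  e (j + k)%N * 'C(j + k, j)%:R * d ^+ j * l ^+ k.

Lemma homog_linear_coef e d l g b N :
  homog (linear_coef e d l) g b N = e N * (d * g + l * b) ^+ N.
Proof.
(* [exprDn] puts the summation index on the second summand; the swap makes j the exponent of g. *)
rewrite addrC exprDn mulr_sumr; apply: eq_bigr => j _.
have jN : (j <= N)%N by rewrite -ltnS.
rewrite /linear_coef (subnKC jN) -[in RHS]mulr_natr !exprMn.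
ring.
Qed.

Lemma norm_linear_coef e d l :
  (fun j k => `|linear_coef e d l j k|) =
  linear_coef (fun k => `|e k|) `|d| `|l|.
Proof.
by apply/funext => j; apply/funext => k; rewrite !normrM !normrX normr_nat.
Qed.

(** Grouped by total degree, both series become one-variable series: at d g + l b for the sum
    itself, at |d| |g| + |l| |b| for the absolute values. *)
Lemma power_series2_linear (f : R -> R) e d l :
    (forall t, cvgn (series (fun k => `|e k * t ^+ k|))) ->
    (forall t, series (fun k => e k * t ^+ k) @ \oo --> f t) ->
  power_series2 (fun g b => f (d * g + l * b)) (linear_coef e d l).
Proof.
move=> abs_e e_f g b; split.
  rewrite norm_linear_coef.
  set t := `|d| * `|g| + `|l| * `|b|.
  rewrite (_ : homog _ _ _ = fun k => `|e k * t ^+ k|) //.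
  apply/funext => N; rewrite homog_linear_coef normrM normrX; congr (_ * _ ^+ _).
  by rewrite ger0_norm // addr_ge0 // mulr_ge0.
rewrite (_ : homog _ _ _ = fun k => e k * (d * g + l * b) ^+ k) //.
by apply/funext => N; rewrite homog_linear_coef.
Qed.

Section LinearCombination.
Variable I : finType.
Implicit Type w : I -> R.

Lemma homog_sum w (a : I -> nat -> nat -> R) g b N :
  homog (fun j k => \sum_i w i * a i j k) g b N = \sum_i w i * homog (a i) g b N.
Proof.
rewrite /homog; under [RHS]eq_bigr do rewrite mulr_sumr.
rewrite exchange_big /=; apply: eq_bigr => j _.
by rewrite !mulr_suml; apply: eq_bigr => i _; rewrite !mulrA.
Qed.

Lemma cvg_series_sum w (u : I -> R^nat) (l : I -> R) :
    (forall i, series (u i) @ \oo --> l i) ->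
  series (fun N => \sum_i w i * u i N) @ \oo --> \sum_i w i * l i.
Proof.
move=> u_l; rewrite (_ : series _ = fun N => \sum_i w i * series (u i) N).
  by apply: cvg_big => [|i _]; [exact: add_continuous|exact: cvgM (cvg_cst _) (u_l i)].
apply/funext => N; rewrite /series /= exchange_big /=.
by apply: eq_bigr => i _; rewrite mulr_sumr.
Qed.

Lemma power_series2_sum w (f : I -> R -> R -> R) (a : I -> nat -> nat -> R) :
    (forall i, power_series2 (f i) (a i)) ->
  power_series2 (fun g b => \sum_i w i * f i g b)
    (fun j k => \sum_i w i * a i j k).
Proof.
move=> fa g b; split; last first.
  rewrite (_ : homog _ _ _ = fun N => \sum_i w i * homog (a i) g b N).
    by apply: cvg_series_sum => i; have [] := fa i g b.
  by apply/funext => N; rewrite homog_sum.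
(* [v] dominates by the triangle inequality on coefficients, and converges as a finite combination
   of convergent series. *)
pose v N := \sum_i `|w i| * homog (fun j k => `|a i j k|) `|g| `|b| N.
have hom_ge0 (c : nat -> nat -> R) N :
    (forall j k, 0 <= c j k) -> 0 <= homog c `|g| `|b| N.
  by move=> c0; apply: sumr_ge0 => j _; rewrite !mulr_ge0 ?exprn_ge0.
apply: (@series_le_cvg _ _ v) => [N|N|N|].
- by apply: hom_ge0.
- by apply: sumr_ge0 => i _; rewrite mulr_ge0 // hom_ge0.
- rewrite /v; under [leRHS]eq_bigr do rewrite mulr_sumr.
  rewrite exchange_big /=; apply: ler_sum => j _.
  under [leRHS]eq_bigr do rewrite !mulrA.
  rewrite -!mulr_suml !ler_wpM2r ?exprn_ge0 //.
  by apply: le_trans (ler_norm_sum _ _ _) _; under eq_bigr do rewrite normrM.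
- apply: (cvgP (\sum_i `|w i| *
    limn (series (homog (fun j k => `|a i j k|) `|g| `|b|)))).
  by apply: cvg_series_sum => i; have [] := fa i g b.
Qed.

Lemma eq_upto_degree_sum D w (f p : I -> R -> R -> R) :
    (forall i, eq_upto_degree D (f i) (p i)) ->
  eq_upto_degree D (fun g b => \sum_i w i * f i g b)
    (fun g b => \sum_i w i * p i g b).
Proof.
move=> /choice[a fap]; exists (fun j k => \sum_i w i * a i j k); split.
  by apply: power_series2_sum => i; have [] := fap i.
move=> g b; under [RHS]eq_bigr do rewrite homog_sum.
rewrite exchange_big /=; apply: eq_bigr => i _.
by rewrite -mulr_sumr; have [_ ->] := fap i.
Qed.

End LinearCombination.

Lemma eq_upto_degree_cos d l :
  eq_upto_degree 3 (fun g b => cos (d * g + l * b))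
    (fun g b => 1 - (d * g + l * b) ^+ 2 / 2).
Proof.
(* The Taylor coefficients of cos at 0. The parity factor kills odd k, so the degree 3 part vanishes
   and the rounding in [k./2] is harmless. *)
pose e k : R := (~~ odd k)%:R * (-1) ^+ k./2 / k`!%:R.
exists (linear_coef e d l); split; last first.
  move=> g b; under eq_bigr do rewrite homog_linear_coef.
  rewrite !big_ord_recr big_ord0 /e /=.
  by rewrite !mul0r !addr0 fact0 expr0 divr1 !mulr1 add0r mul1r expr1 mulN1r mulNr mulrC.
have eE t : (fun k => e k * t ^+ k) = cos_coeff t by rewrite cos_coeffE.
apply: power_series2_linear => t.
  (* The absolute values are dominated termwise by the exponential series at |t|. *)
  apply: series_le_cvg; last exact: (is_cvg_series_exp_coeff `|t|).
  - by move=> k.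
  - by move=> k; rewrite divr_ge0.
  - move=> k; rewrite /exp_coeff /e !normrM normfV normrX normrN normr1 expr1n.
    rewrite !normr_nat normrX mulr1 mulrAC.
    by case: odd; [rewrite !mul0r divr_ge0 | rewrite mul1r].
by rewrite eE unlock; exact: is_cvg_series_cos_coeff.
Qed.

End PowerSeries.

(** * The complex exponential e^(-it) *)

Section ComplexExponential.
Context {R : realType}.
Implicit Types t : R.
Local Notation C := (R[i] : numFieldType).

Lemma cvg_real_complex (u : R^nat) (l : R) :
  u @ \oo --> l -> (fun k => (u k)%:C : C) @ \oo --> (l%:C : C).
Proof.
move=> /cvgrPdist_lt u_l; apply/cvgrPdist_lt => e e0.
(* A positive element of R[i] is real, so the radius can be taken in R. *)
have [e' ee'] : exists e', e = e'%:C by apply/complex_realP/gtr0_real.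
move: e0; rewrite {}ee' ltcR => /u_l; apply: filterS => k.
by rewrite -rmorphB /= normc_def /= expr0n addr0 sqrtr_sqr ltcR.
Qed.

(* [cisN t] is e^(-it). *)
Definition cisN t : R[i] := (cos t)%:C - 'i * (sin t)%:C.

(** Since (-it)^2 = -t^2, even powers are real and odd ones purely imaginary; the coefficient of the
    other parity is zero. *)
Lemma exp_coeff_cisN t k :
  (k`!%:R)^-1 * (- ('i * t%:C)) ^+ k =
  (cos_coeff t k)%:C - 'i * (sin_coeff t k)%:C :> R[i].
Proof.
have sqr_it : (- ('i * t%:C)) ^+ 2 = (- t ^+ 2)%:C :> R[i].
  by rewrite sqrrN exprMn sqrCi mulN1r -rmorphXn -rmorphN.
have even_pow j : (- ('i * t%:C)) ^+ j.*2 = ((-1) ^+ j * t ^+ j.*2)%:C :> R[i].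
  by rewrite -mul2n !exprM sqr_it -rmorphXn /= [in LHS]exprNn.
have facE j : (j`!%:R)^-1 = ((j`!%:R)^-1)%:C :> R[i].
  by rewrite fmorphV rmorph_nat.
rewrite facE -(odd_double_half k) /cos_coeff /sin_coeff.
case: (odd k) => /=.
  rewrite add1n /= odd_double /= exprS even_pow doubleK !mul0r rmorph0 add0r.
  rewrite mul1r exprS !rmorphM /=.
  ring.
rewrite add0n odd_double doubleK even_pow !mul0r rmorph0 mulr0 subr0 mul1r.
by rewrite -rmorphM mulrC.
Qed.

Lemma cvg_exp_cisN t :
  series (fun k => (k`!%:R)^-1 * (- ('i * t%:C)) ^+ k : C) @ \oo -->
  (cisN t : C).
Proof.
rewrite (_ : series _ = fun N => (series (cos_coeff t) N)%:C -
    'i * (series (sin_coeff t) N)%:C); last first.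
  apply/funext => N; rewrite /series /= !rmorph_sum mulr_sumr -sumrB.
  by apply: eq_bigr => k _; rewrite exp_coeff_cisN.
apply: (@cvgB C C nat \oo _ (fun N => (series (cos_coeff t) N)%:C)
  (fun N => 'i * (series (sin_coeff t) N)%:C)).
  by apply: cvg_real_complex; rewrite unlock; exact: is_cvg_series_cos_coeff.
apply: (@cvgM C nat \oo _ (fun=> 'i)
  (fun N => (series (sin_coeff t) N)%:C)); first exact: cvg_cst.
by apply: cvg_real_complex; rewrite unlock; exact: is_cvg_series_sin_coeff.
Qed.

Lemma cisND t1 t2 : cisN (t1 + t2) = cisN t1 * cisN t2.
Proof.
rewrite /cisN cosD sinD !(rmorphB, rmorphD, rmorphM) /=.
rewrite mulrBl !mulrBr (mulrACA 'i) -expr2 sqrCi mulN1r opprK; ring.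
Qed.

(** The squared modulus is the square of the cosine sum plus that of the sine sum; the products pair
    up by the formula for cos (a - b). *)
Lemma normc_sum_cisN (I : finType) (w t : I -> R) :
  ComplexField.Normc.normc (\sum_i (w i)%:C * cisN (t i)) ^+ 2 =
  \sum_i w i * \sum_j w j * cos (t i - t j).
Proof.
have -> : \sum_i (w i)%:C * cisN (t i) =
    (\sum_i w i * cos (t i)) -i* (\sum_i w i * sin (t i)).
  have iE : 'i%C = 'i :> R[i] by [].
  rewrite [RHS]complexE /= !rmorphN !rmorph_sum /= mulrN mulr_sumr -sumrB.
  by apply: eq_bigr => i _; rewrite !rmorphM /= iE mulrBr mulrCA.
rewrite /= sqr_sqrtr ?addr_ge0 ?sqr_ge0 // sqrrN !expr2 !mulr_suml -big_split.
apply: eq_bigr => i _ /=; rewrite -!mulrA -mulrDr; congr (_ * _).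
rewrite !mulr_sumr -big_split; apply: eq_bigr => j _ /=.
by rewrite cosB; ring.
Qed.

End ComplexExponential.

(** * Matrix exponential from a complete family of orthogonal idempotents *)

Section SpectralDecomposition.
Context {K : numFieldType} {m : nat} {I : finType}.
Variables (P : I -> 'M[K]_m).
Hypothesis P_ortho : forall i j, P i *m P j = if i == j then P i else 0.
Hypothesis P_total : \sum_i P i = 1%:M.

Lemma exp_spectral (mu : I -> K) k :
  (\sum_i mu i *: P i) ^+ k = \sum_i mu i ^+ k *: P i.
Proof.
elim: k => [|k IH]; first by under [RHS]eq_bigr do rewrite expr0 scale1r; rewrite P_total.
rewrite exprS IH mulr_suml; apply: eq_bigr => i _.
rewrite mulr_sumr (bigD1 i) //= big1 => [|j ji].
  rewrite addr0 -[LHS]/(_ *m _) -scalemxAl -scalemxAr P_ortho eqxx scalerA.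
  by rewrite exprS.
by rewrite -[LHS]/(_ *m _) -scalemxAl -scalemxAr P_ortho eq_sym (negbTE ji) !scaler0.
Qed.

(** Powers act on the eigenvalues alone, so every partial sum is a combination of the [P i] and the
    limit is taken coefficient by coefficient. *)
Lemma expmx_spectral (mu e : I -> K) :
    (forall i, series (fun k => (k`!%:R)^-1 * mu i ^+ k) @ \oo --> e i) ->
  expmx (\sum_i mu i *: P i) = \sum_i e i *: P i.
Proof.
move=> mu_e; apply: cvg_lim; first exact: norm_hausdorff.
rewrite (_ : series _ = fun N => \sum_i
    series (fun k => (k`!%:R)^-1 * mu i ^+ k) N *: P i).
  by apply: cvg_big => [|i _]; [exact: add_continuous | exact: cvgZr_tmp].
apply/funext => N; rewrite /series /=; under [RHS]eq_bigr do rewrite scaler_suml.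
rewrite exchange_big /=; apply: eq_bigr => k _.
by rewrite exp_spectral scaler_sumr; apply: eq_bigr => i _; rewrite scalerA.
Qed.

End SpectralDecomposition.

(** * Diagonalisation of B by Walsh characters and of C by the computational basis *)

Section Hadamard.
Context {R : realType} {n : nat}.
Implicit Types (x y z q : bits n) (c h : bits n -> R) (j : 'I_n).

Lemma bits_neq x y : x != y -> exists j, x j != y j.
Proof.
move=> xy; apply/existsP; rewrite -negb_forall; apply: contra xy => /forallP xy.
by apply/eqP/ffunP => j; apply/eqP.
Qed.

(** The Walsh character (-1)^(x . y), up to normalisation an entry of the n-qubit Hadamard
    transform. *)
Definition chi x y : R := \prod_(k < n) (-1) ^+ (x k && y k).

Lemma chiC x y : chi x y = chi y x.
Proof. by apply: eq_bigr => k _; rewrite andbC. Qed.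

Lemma flipK j : involutive (fun x => flip x j).
Proof. by move=> x; apply/ffunP => k; rewrite !ffunE; case: eqP; rewrite ?negbK. Qed.

(** This makes [chi ^~ y] a common eigenvector of all the X_j. *)
Lemma chi_flip x y j : chi (flip x j) y = (-1) ^+ y j * chi x y.
Proof.
rewrite /chi (bigD1 j) //= [in RHS](bigD1 j) //= mulrA; congr (_ * _).
  by rewrite ffunE eqxx; case: (x j); case: (y j); rewrite /= ?mulrNN ?mulr1 ?mul1r.
by apply: eq_bigr => k kj; rewrite ffunE (negbTE kj).
Qed.

(** The sum factors over the bits: a factor is 2 where x and z agree, and 0 where they differ. *)
Lemma chi_ortho x z : \sum_y chi x y * chi z y = (x == z)%:R * 2 ^+ n.
Proof.
have -> : \sum_y chi x y * chi z y =
    \prod_(k < n) \sum_(b : bool) (-1) ^+ (x k && b) * (-1) ^+ (z k && b) :> R.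
  by rewrite bigA_distr_bigA; apply: eq_bigr => y _; rewrite -big_split.
have [->|xz] := eqVneq x z.
  rewrite mul1r -[in RHS](card_ord n) -prodr_const; apply: eq_bigr => k _.
  by rewrite big_bool /= andbF; case: (z k); rewrite /= ?mulrNN !mulr1.
have [k xzk] := bits_neq xz.
rewrite mul0r (bigD1 k) //= big_bool !andbT !andbF.
by case: (x k) (z k) xzk => [] [] //= _; rewrite ?(mulr1, mul1r) ?addNr ?subrr mul0r.
Qed.

Definition mixing_eigenvalue y : R := \sum_(j < n) (-1) ^+ y j.

Lemma mixing_eigenvalueM x y :
  mixing_eigenvalue y * chi x y = \sum_(j < n) chi (flip x j) y.
Proof. by rewrite mulr_suml; apply: eq_bigr => j _; rewrite chi_flip. Qed.

(* The (x, q) matrix entry of h(B): the characters [chi ^~ y] are eigenvectors of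
   the mixing Hamiltonian B, with eigenvalue [mixing_eigenvalue y]. *)
Definition hadamard_kernel h x q : R := \sum_y chi x y * chi q y / 2 ^+ n * h y.

Lemma expr2n_neq0 : 2 ^+ n != 0 :> R.
Proof. by rewrite expf_neq0. Qed.

Lemma hadamard_kernel1 x q : hadamard_kernel (fun=> 1) x q = (x == q)%:R.
Proof.
rewrite /hadamard_kernel; under eq_bigr do rewrite mulr1.
by rewrite -mulr_suml chi_ortho mulfK ?expr2n_neq0.
Qed.

(** The entry <x|B h(B)|q>, with B acting on <x| by summing its single-bit flips. *)
Lemma hadamard_kernelM h x q :
  hadamard_kernel (fun y => mixing_eigenvalue y * h y) x q =
  \sum_(j < n) hadamard_kernel h (flip x j) q.
Proof.
rewrite exchange_big /=; apply: eq_bigr => y _.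
rewrite -!mulr_suml -mixing_eigenvalueM; ring.
Qed.

Lemma hadamard_kernel_eigenvalue x q :
  hadamard_kernel mixing_eigenvalue x q = \sum_(j < n) (flip x j == q)%:R.
Proof.
under [RHS]eq_bigr do rewrite -hadamard_kernel1.
by rewrite -hadamard_kernelM; apply: eq_bigr => y _; rewrite mulr1.
Qed.

Lemma sum_delta x c : \sum_q (x == q)%:R * c q = c x.
Proof.
rewrite (bigD1 x) //= eqxx mul1r big1 ?addr0 // => q.
by rewrite eq_sym => /negbTE ->; rewrite mul0r.
Qed.

Lemma sum_hadamard_kernelM h x c :
  \sum_q hadamard_kernel (fun y => mixing_eigenvalue y * h y) x q * c q =
  \sum_(j < n) \sum_q hadamard_kernel h (flip x j) q * c q.
Proof.
rewrite exchange_big /=; apply: eq_bigr => q _.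
by rewrite hadamard_kernelM mulr_suml.
Qed.

(** The rank-one projector on [chi ^~ y] normalised by 2^(-n/2). *)
Definition hadamard_proj y : operator R n :=
  \matrix_(p, q) (chi (enum_val p) y * chi (enum_val q) y / 2 ^+ n)%:C.

Lemma sum_enum_val (V : nmodType) (F : bits n -> V) :
  \sum_(r < #|{: bits n}|) F (enum_val r) = \sum_x F x.
Proof.
rewrite [RHS](reindex (fun r : 'I_#|{: bits n}| => enum_val r)) //.
exact/onW_bij/enum_val_bij.
Qed.

Lemma hadamard_proj_ortho y z :
  hadamard_proj y *m hadamard_proj z = if y == z then hadamard_proj y else 0.
Proof.
apply/matrixP => p q; rewrite mxE.
under eq_bigr do rewrite !mxE -rmorphM.
rewrite -rmorph_sum /= (sum_enum_val (fun r => chi (enum_val p) y * chi r y / 2 ^+ n *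
  (chi r z * chi (enum_val q) z / 2 ^+ n))).
transitivity ((chi (enum_val p) y * chi (enum_val q) z / 2 ^+ n / 2 ^+ n *
  \sum_r chi y r * chi z r)%:C : R[i]).
  congr (_%:C); rewrite mulr_sumr; apply: eq_bigr => r _.
  by rewrite (chiC y) (chiC z); ring.
rewrite chi_ortho; have [<-|_] := eqVneq y z; rewrite !mxE ?mul0r ?mulr0 //.
by rewrite mul1r divfK ?expr2n_neq0.
Qed.

Lemma hadamard_proj_sum h (p q : 'I_#|{: bits n}|) :
  (\sum_y (h y)%:C *: hadamard_proj y) p q =
  (hadamard_kernel h (enum_val p) (enum_val q))%:C.
Proof.
rewrite summxE rmorph_sum /=; apply: eq_bigr => y _.
by rewrite !mxE -rmorphM mulrC.
Qed.

Lemma hadamard_proj_total : \sum_y hadamard_proj y = 1%:M.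
Proof.
transitivity (\sum_y ((fun=> 1 : R) y)%:C *: hadamard_proj y).
  by apply: eq_bigr => y _; rewrite rmorph1 scale1r.
apply/matrixP => p q; rewrite hadamard_proj_sum hadamard_kernel1 mxE.
by rewrite (inj_eq enum_val_inj) rmorph_nat.
Qed.

Lemma mixing_ham_spectral :
  mixing_ham = \sum_y (mixing_eigenvalue y)%:C *: hadamard_proj y :> operator R n.
Proof.
apply/matrixP => p q; rewrite hadamard_proj_sum hadamard_kernel_eigenvalue.
rewrite summxE rmorph_sum /=; apply: eq_bigr => j _.
(* The (p, q) entry of X_j is read off as coordinate p of X_j applied to the q-th basis ket. *)
have := congr1 (fun psi : state R n => psi p 0) (X_op_ket j (enum_val q)).
rewrite -colE [X in _ = X]mxE mxE enum_valK andbT => ->.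
rewrite rmorph_nat; congr (nat_of_bool _)%:R.
rewrite -[p in LHS]enum_valK (inj_eq enum_rank_inj).
(* The involution moves the flip to the other side of the equality test. *)
by rewrite -(can_eq (@flipK j) (flip _ _)) /= flipK.
Qed.

(** Convertible with the projector in [cost_ham], which is therefore in spectral form by
    definition. *)
Definition basis_proj q : operator R n := ket q *m adjmx (ket q).

Lemma adjmx_ket q : adjmx (ket q) = delta_mx 0 (enum_rank q) :> 'M[R[i]]__.
Proof.
by apply/matrixP => i p; rewrite !ord1 !mxE conjc_nat !eqxx andbT.
Qed.

Lemma basis_projE q : basis_proj q = delta_mx (enum_rank q) (enum_rank q).
Proof. by rewrite /basis_proj adjmx_ket mul_delta_mx. Qed.

Lemma basis_proj_ortho x q :
  basis_proj x *m basis_proj q = if x == q then basis_proj x else 0.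
Proof.
rewrite !basis_projE mul_delta_mx_cond (inj_eq enum_rank_inj).
by case: eqP => [->|_]; rewrite ?mulr1n.
Qed.

Lemma basis_proj_total : \sum_q basis_proj q = 1%:M.
Proof.
rewrite mx1_sum_delta -(sum_enum_val (fun q => basis_proj q)).
by apply: eq_bigr => p _; rewrite basis_projE enum_valK.
Qed.

End Hadamard.

(** * QAOA amplitudes, moments of the phases, and the expansion of P_1 *)

Section QAOA.
Context {R : realType} {n : nat}.
Implicit Types (x y q : bits n) (c : bits n -> R) (g b : R).

Lemma expmx_mixing_ham b :
  expmx (- ('i * b%:C) *: mixing_ham) =
  \sum_y cisN (b * mixing_eigenvalue y) *: hadamard_proj y :> operator R n.
Proof.
rewrite mixing_ham_spectral scaler_sumr.
under eq_bigr do rewrite scalerA mulNr -mulrA -rmorphM.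
apply: expmx_spectral => [y z||y].
- exact: hadamard_proj_ortho.
- exact: hadamard_proj_total.
- exact: cvg_exp_cisN.
Qed.

Lemma expmx_cost_ham c g :
  expmx (- ('i * g%:C) *: cost_ham c) = \sum_q cisN (g * c q) *: basis_proj q.
Proof.
rewrite scaler_sumr.
under eq_bigr do rewrite scalerA mulNr -mulrA -rmorphM.
apply: expmx_spectral => [y z||y].
- exact: basis_proj_ortho.
- exact: basis_proj_total.
- exact: cvg_exp_cisN.
Qed.

Lemma init_stateE q :
  (init_state : state R n) (enum_rank q) 0 = ((Num.sqrt (2 ^+ n))^-1)%:C.
Proof.
rewrite mxE summxE (bigD1 q) //= big1 => [|x /negbTE xq].
  by rewrite mxE !eqxx addr0 mulr1.
by rewrite mxE (inj_eq enum_rank_inj) eq_sym xq.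
Qed.

(* For p = (y, q), the product <x|Pi_y|q><q|s>, where Pi_y is the projector on the
   eigenvector [chi ^~ y] of the mixing Hamiltonian. *)
Definition path_weight x (p : bits n * bits n) : R :=
  (Num.sqrt (2 ^+ n))^-1 * (chi x p.1 * chi p.2 p.1 / 2 ^+ n).

(** Both exponentials are expanded spectrally; [cisND] merges the cost and mixing phases of each
    path into one linear form in g and b. *)
Lemma qaoa_stateE c g b x :
  qaoa_state c g b (enum_rank x) 0 =
  \sum_p (path_weight x p)%:C * cisN (c p.2 * g + mixing_eigenvalue p.1 * b).
Proof.
rewrite -(pair_bigA _ (fun y q => (path_weight x (y, q))%:C *
  cisN (c q * g + mixing_eigenvalue y * b))) /=.
rewrite /qaoa_state expmx_mixing_ham expmx_cost_ham !mulmx_suml summxE.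
apply: eq_bigr => y _; rewrite mulmx_sumr summxE; apply: eq_bigr => q _.
rewrite -!scalemxAl -scalemxAr -mulmxA adjmx_ket_mul init_stateE mul_mx_scalar.
rewrite -scalemxAr -colE !mxE !enum_rankK cisND !rmorphM /=.
by rewrite (mulrC (c q)) (mulrC (mixing_eigenvalue y)); ring.
Qed.

Lemma probE (psi : state R n) x :
  prob psi x = ComplexField.Normc.normc (psi (enum_rank x) 0) ^+ 2.
Proof. by rewrite /prob adjmx_ket_mul mxE eqxx. Qed.

Lemma invr_sqrt2n_sqr : (Num.sqrt (2 ^+ n))^-1 ^+ 2 = (2 ^+ n)^-1 :> R.
Proof. by rewrite exprVn sqr_sqrtr ?exprn_ge0. Qed.

Lemma P0E x : P0 x = (2 ^+ n)^-1 :> R.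
Proof.
rewrite /P0 probE init_stateE /= expr0n addr0 sqr_sqrtr ?sqr_ge0 //.
exact: invr_sqrt2n_sqr.
Qed.

Lemma P1E c g b x :
  P1 c g b x = \sum_p path_weight x p * \sum_p' path_weight x p' *
    cos ((c p.2 - c p'.2) * g + (mixing_eigenvalue p.1 - mixing_eigenvalue p'.1) * b).
Proof.
rewrite /P1 probE qaoa_stateE normc_sum_cisN.
apply: eq_bigr => p _; congr (_ * _); apply: eq_bigr => p' _.
by congr (_ * cos _); ring.
Qed.

(** Summing over y first assembles h(B): both sides are <x|h(B) C|s>. *)
Lemma sum_path_weight x h c :
  \sum_p path_weight x p * (h p.1 * c p.2) =
  (Num.sqrt (2 ^+ n))^-1 * \sum_q hadamard_kernel h x q * c q.
Proof.
rewrite -(pair_bigA _ (fun y q => path_weight x (y, q) * (h y * c q))) /=.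
rewrite exchange_big mulr_sumr; apply: eq_bigr => q _ /=.
rewrite mulr_suml mulr_sumr; apply: eq_bigr => y _.
by rewrite /path_weight /=; ring.
Qed.

Lemma sum_path_weight0 x c :
  \sum_p path_weight x p * c p.2 = (Num.sqrt (2 ^+ n))^-1 * c x.
Proof.
transitivity (\sum_p path_weight x p * ((fun=> 1) p.1 * c p.2)).
  by apply: eq_bigr => p _; rewrite mul1r.
rewrite (sum_path_weight x (fun=> 1)); congr (_ * _); rewrite -[RHS]sum_delta.
by apply: eq_bigr => q _; rewrite hadamard_kernel1.
Qed.

(** An extra factor B stands leftmost, so it acts on <x| and replaces x by its neighbours. *)
Lemma sum_path_weightM x h c :
  \sum_p path_weight x p * (mixing_eigenvalue p.1 * h p.1 * c p.2) =
  \sum_(j < n) \sum_p path_weight (flip x j) p * (h p.1 * c p.2).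
Proof.
rewrite (sum_path_weight x (fun y => mixing_eigenvalue y * h y)).
rewrite sum_hadamard_kernelM mulr_sumr.
by apply: eq_bigr => j _; rewrite sum_path_weight.
Qed.

Lemma sum_path_weight1 x c :
  \sum_p path_weight x p * (mixing_eigenvalue p.1 * c p.2) =
  (Num.sqrt (2 ^+ n))^-1 * \sum_(j < n) c (flip x j).
Proof.
transitivity (\sum_p path_weight x p *
    (mixing_eigenvalue p.1 * (fun=> 1) p.1 * c p.2)).
  by apply: eq_bigr => p _; rewrite mulr1.
rewrite (sum_path_weightM x (fun=> 1)) mulr_sumr; apply: eq_bigr => j _.
by under eq_bigr do rewrite mul1r; rewrite sum_path_weight0.
Qed.

(** This is <x|B^2|s>, and |s> is an eigenvector of B with eigenvalue n. *)
Lemma sum_path_weight2 x :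
  \sum_p path_weight x p * (mixing_eigenvalue p.1 ^+ 2) =
  (Num.sqrt (2 ^+ n))^-1 * n%:R ^+ 2.
Proof.
transitivity (\sum_p path_weight x p *
    (mixing_eigenvalue p.1 * mixing_eigenvalue p.1 * (fun=> 1) p.2)).
  by apply: eq_bigr => p _; rewrite mulr1.
rewrite (sum_path_weightM x mixing_eigenvalue (fun=> 1)).
under eq_bigr do rewrite (sum_path_weight1 _ (fun=> 1)) sumr_const card_ord.
by rewrite sumr_const card_ord -mulr_natr; ring.
Qed.

Lemma sum_path_weight_phase x c g b :
  \sum_p path_weight x p * (c p.2 * g + mixing_eigenvalue p.1 * b) =
  (Num.sqrt (2 ^+ n))^-1 * (c x * g + n%:R * b).
Proof.
under eq_bigr do rewrite mulrDr !mulrA.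
rewrite big_split -!mulr_suml /= sum_path_weight0.
have := sum_path_weight1 x (fun=> 1); rewrite /= sumr_const card_ord.
under eq_bigr do rewrite mulr1.
by move=> ->; ring.
Qed.

(** The cross term is 2 g b <x|BC|s>: with B left of C, the cost is evaluated at the neighbours of
    x, which is the source of dc. *)
Lemma sum_path_weight_phase_sqr x c g b :
  \sum_p path_weight x p * (c p.2 * g + mixing_eigenvalue p.1 * b) ^+ 2 =
  (Num.sqrt (2 ^+ n))^-1 * (c x ^+ 2 * g ^+ 2 +
    2 * g * b * \sum_(j < n) c (flip x j) + n%:R ^+ 2 * b ^+ 2).
Proof.
transitivity (\sum_p (path_weight x p * (c p.2 ^+ 2) * g ^+ 2 +
    (path_weight x p * (mixing_eigenvalue p.1 * c p.2)) * (2 * g * b) +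
    (path_weight x p * mixing_eigenvalue p.1 ^+ 2) * b ^+ 2)).
  by apply: eq_bigr => p _; ring.
rewrite !big_split /= -!mulr_suml (sum_path_weight0 x (fun q => c q ^+ 2)).
by rewrite sum_path_weight1 sum_path_weight2; ring.
Qed.

(** Expanding (t_i - t_j)^2, the two pure squares each give S_0 S_2 and the mixed term gives -2
    S_1^2. *)
Lemma sum_half_sqr_diff (I : finType) (w t : I -> R) :
  \sum_i w i * \sum_j w j * (1 - (t i - t j) ^+ 2 / 2) =
  (\sum_i w i) ^+ 2 + (\sum_i w i * t i) ^+ 2 -
  (\sum_i w i) * (\sum_i w i * t i ^+ 2).
Proof.
set S0 := \sum_i w i; set S1 := \sum_i w i * t i; set S2 := \sum_i _ * _ ^+ 2.
have inner i : \sum_j w j * (1 - (t i - t j) ^+ 2 / 2) =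
    S0 - t i ^+ 2 / 2 * S0 + t i * S1 - S2 / 2.
  rewrite /S0 /S1 /S2 !mulr_sumr mulr_suml -sumrB -big_split -sumrB /=.
  by apply: eq_bigr => j _; field.
under eq_bigr do rewrite inner.
transitivity (\sum_i (w i * S0 - w i * t i ^+ 2 * (S0 / 2) + w i * t i * S1 -
    w i * (S2 / 2))).
  by apply: eq_bigr => i _; ring.
rewrite sumrB big_split sumrB -!mulr_suml /= -/S0 -/S1 -/S2.
by field.
Qed.

Lemma cost_divE c x : cost_div c x = \sum_(j < n) c (flip x j) - n%:R * c x.
Proof. by rewrite /cost_div sumrB sumr_const card_ord mulr_natl. Qed.

Lemma P1_expansion c x :
  eq_upto_degree 3 (fun g b => P1 c g b x)
    (fun g b => P0 x - 2 * g * b / 2 ^+ n * cost_div c x).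
Proof.
have -> : (fun g b => P1 c g b x) = (fun g b => \sum_p path_weight x p *
    \sum_p' path_weight x p' * cos ((c p.2 - c p'.2) * g +
      (mixing_eigenvalue p.1 - mixing_eigenvalue p'.1) * b)).
  by apply/funext => g; apply/funext => b; exact: P1E.
have -> : (fun g b => P0 x - 2 * g * b / 2 ^+ n * cost_div c x) =
    (fun g b => \sum_p path_weight x p * \sum_p' path_weight x p' *
      (1 - ((c p.2 - c p'.2) * g +
        (mixing_eigenvalue p.1 - mixing_eigenvalue p'.1) * b) ^+ 2 / 2)).
  apply/funext => g; apply/funext => b.
  pose t (p : bits n * bits n) := c p.2 * g + mixing_eigenvalue p.1 * b.
  have S0 : \sum_p path_weight x p = (Num.sqrt (2 ^+ n))^-1.
    have := sum_path_weight0 x (fun=> 1).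
    by under eq_bigr do rewrite mulr1; rewrite mulr1.
  transitivity (\sum_p path_weight x p * \sum_p' path_weight x p' *
      (1 - (t p - t p') ^+ 2 / 2)).
    (* The g^2 and b^2 terms cancel between S_1^2 and S_0 S_2; the g b terms leave n c(x) minus the
       sum over neighbours, that is -dc(x). *)
    rewrite sum_half_sqr_diff S0 sum_path_weight_phase sum_path_weight_phase_sqr.
    by rewrite P0E cost_divE -!invr_sqrt2n_sqr; ring.
  apply: eq_bigr => p _; congr (_ * _); apply: eq_bigr => p' _.
  by congr (_ * (1 - _ ^+ 2 / 2)); rewrite /t; ring.
(* Both functions are now the same finite combination, of cosines and of their quadratic
   truncations. *)
apply: eq_upto_degree_sum => p; apply: eq_upto_degree_sum => p'.
exact: eq_upto_degree_cos.
Qed.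

(** * The expected cost as the cost-weighted sum of the probabilities *)

Lemma expectation_cost_ham (psi : state R n) c :
  Defs.expectation psi (cost_ham c) = \sum_x c x * prob psi x.
Proof.
apply: (@complexI R); rewrite -expectation_cost_hamE rmorph_sum /=.
rewrite mulmx_sumr mulmx_suml summxE; apply: eq_bigr => x _.
rewrite -scalemxAr -scalemxAl mxE rmorphM /=; congr (_ * _).
rewrite mulmxA -(mulmxA (_ *m ket x)) adjmx_ket_mul mul_mx_scalar mxE -colE.
rewrite /adjmx !mxE probE -sqr_normc normc_def rmorphXn.
by case: (psi _ _).
Qed.

Lemma E1_expansion c :
  eq_upto_degree 3 (E1 c)
    (fun g b => E0 c - 2 * g * b / 2 ^+ n * \sum_x c x * cost_div c x).
Proof.
have -> : E1 c = (fun g b => \sum_x c x * P1 c g b x).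
  by apply/funext => g; apply/funext => b; exact: expectation_cost_ham.
have -> : (fun g b => E0 c - 2 * g * b / 2 ^+ n * \sum_x c x * cost_div c x) =
    (fun g b => \sum_x c x * (P0 x - 2 * g * b / 2 ^+ n * cost_div c x)).
  apply/funext => g; apply/funext => b.
  rewrite /E0 expectation_cost_ham mulr_sumr -sumrB.
  by apply: eq_bigr => x _; rewrite /P0; ring.
apply: eq_upto_degree_sum => x; exact: P1_expansion.
Qed.

(** * The sign of the sum of c dc *)

Lemma sum_cost_div c :
  \sum_x c x * cost_div c x = - (\sum_x \sum_(j < n) pdiff c j x ^+ 2) / 2.
Proof.
have flip_sum (f : bits n -> R) j : \sum_x f (flip x j) = \sum_x f x.
  by rewrite [RHS](reindex_inj (inv_inj (@flipK n j))).
under eq_bigr do rewrite mulr_sumr.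
rewrite exchange_big [in RHS]exchange_big /= -sumrN mulr_suml.
apply: eq_bigr => j _; apply: (@mulIf _ 2) => //; rewrite divfK //.
rewrite mulr_natr mulr2n.
(* After doubling, one copy is reindexed by the flip: c(x^(j)) (c(x) - c(x^(j))) + c(x) (c(x^(j)) -
   c(x)) is minus the square of the partial difference. *)
rewrite -{1}(flip_sum (fun x => c x * pdiff c j x) j) -big_split -sumrN /=.
by apply: eq_bigr => x _; rewrite /pdiff (@flipK n j); ring.
Qed.

(** Induction on the Hamming distance from x to y: flipping a bit where they differ brings x
    strictly closer to y. *)
Lemma flip_invariant_const c :
  (forall x j, c (flip x j) = c x) -> forall x y, c x = c y.
Proof.
move=> cflip x y.
elim: {x}_.+1 {-2}x (ltnSn #|[set k | x k != y k]%SET|) => // m IH x.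
rewrite ltnS => le_m; have [->//|xy] := eqVneq x y.
have [j xyj] := bits_neq xy.
rewrite -(cflip x j); apply: IH; apply: leq_trans le_m; apply: proper_card.
apply/properP; split; last first.
  by exists j; rewrite !inE // ffunE eqxx; case: (x j) (y j) xyj => [] [].
apply/fintype.subsetP => k; rewrite !inE ffunE; have [->|//] := eqVneq k j.
by rewrite xyj.
Qed.

Lemma sum_cost_div_lt0 c :
  ~ (exists k : R, forall x, c x = k) -> \sum_x c x * cost_div c x < 0.
Proof.
move=> nconst; rewrite sum_cost_div mulNr oppr_lt0 divr_gt0 // lt_neqAle.
have sq_ge0 x : 0 <= \sum_(j < n) pdiff c j x ^+ 2.
  by apply: sumr_ge0 => j _; exact: sqr_ge0.
(* If the sum of squares were zero, every partial difference would vanish and c would be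
   flip-invariant, hence constantly its value at the zero string. *)
rewrite sumr_ge0 // andbT eq_sym; apply/eqP => /psumr_eq0P sq0.
apply: nconst; exists (c [ffun=> false]) => x.
apply: flip_invariant_const => {}x j; apply/eqP; rewrite -subr_eq0 -sqrf_eq0.
apply/eqP; have /psumr_eq0P -> // := sq0 (fun x _ => sq_ge0 x) x isT.
by move=> k _; exact: sqr_ge0.
Qed.

End QAOA.

Theorem theorem2p2p1 (R : realType) (n : nat) (c : bits n -> R) :
  [/\ (forall x : bits n, P0 x = (2 ^+ n)^-1 :> R),
      (forall x : bits n,
         eq_upto_degree 3 (fun g b => P1 c g b x)
           (fun g b => P0 x - 2 * g * b / 2 ^+ n * cost_div c x)),
      eq_upto_degree 3 (E1 c)
        (fun g b =>
           E0 c - 2 * g * b / 2 ^+ n * \sum_(x : bits n) c x * cost_div c x)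
    & (~ (exists k : R, forall x : bits n, c x = k)) ->
      \sum_(x : bits n) c x * cost_div c x < 0].
Proof.
split.
- exact: P0E.
- exact: P1_expansion.
- exact: E1_expansion.
- exact: sum_cost_div_lt0.
Qed.
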